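(* Let $\mathbb{I}$ be a nonempty real interval, let $n\geqslant 1$, and let $\mathsf{F}\colon\mathbb{I}^n\to\mathbb{R}$ be a function that is nondecreasing in each variable and satisfies $\mathrm{ran}(\delta_{\mathsf{F}})=\mathrm{ran}(\mathsf{F})$. Let $\mathsf{M}_{\mathsf{F}}\colon\mathbb{I}^n\to\mathbb{R}$ be the function associated with $\mathsf{F}$ defined in the context. Then $\mathrm{ran}(\mathsf{M}_{\mathsf{F}})\subseteq\mathbb{I}$ and $\mathsf{F}=\delta_{\mathsf{F}}\circ\mathsf{M}_{\mathsf{F}}$. Moreover, $\mathsf{M}_{\mathsf{F}}$ is nondecreasing (in each variable) and idempotent.
   Context: Intervals may be bounded or unbounded. For $\mathsf{F}\colon\mathbb{I}^n\to\mathbb{R}$, the diagonal section is $\delta_{\mathsf{F}}\colon\mathbb{I}\to\mathbb{R}$, $\delta_{\mathsf{F}}(x)=\mathsf{F}(x,\ldots,x)$; $\mathrm{ran}$ denotes range. A function $\mathsf{G}\colon\mathbb{I}^n\to\mathbb{I}$ is idempotent if $\delta_{\mathsf{G}}(x)=x$ for all $x\in\mathbb{I}$. $\mathsf{Min}(\mathbf{x})=\min_i x_i$, $\mathsf{Max}(\mathbf{x})=\max_i x_i$. Definition of $\mathsf{M}_{\mathsf{F}}$ (for $\mathsf{F}\colon\mathbb{I}^n\to\mathbb{R}$ nondecreasing in each variable with $\mathrm{ran}(\delta_{\mathsf{F}})=\mathrm{ran}(\mathsf{F})$). Let $d_\infty(\mathbf{x},S)=\inf_{\mathbf{x}'\in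 S}\max_i|x_i-x_i'|$, with $d_\infty(\mathbf{x},\varnothing)=\infty$. Let $\mathsf{F}_<^{-1}(y)=\{\mathbf{x}\in\mathbb{I}^n:\mathsf{F}(\mathbf{x})<y\}$ and $\mathsf{F}_>^{-1}(y)=\{\mathbf{x}\in\mathbb{I}^n:\mathsf{F}(\mathbf{x})>y\}$. For $\mathbf{x}\in\mathbb{I}^n$ put $a_{\mathsf{F}}(\mathbf{x})=\inf\delta_{\mathsf{F}}^{-1}\{\mathsf{F}(\mathbf{x})\}$, $b_{\mathsf{F}}(\mathbf{x})=\sup\delta_{\mathsf{F}}^{-1}\{\mathsf{F}(\mathbf{x})\}$ (in $[-\infty,\infty]$), $d_{\mathsf{F}}^<(\mathbf{x})=d_\infty(\mathbf{x},\mathsf{F}_<^{-1}(\mathsf{F}(\mathbf{x})))$, $d_{\mathsf{F}}^>(\mathbf{x})=d_\infty(\mathbf{x},\mathsf{F}_>^{-1}(\mathsf{F}(\mathbf{x})))$ (in $[0,\infty]$), and $\Omega_{\mathsf{F}}=\{\mathbf{x}\in\mathbb{I}^n: d_{\mathsf{F}}^>(\mathbf{x})+d_{\mathsf{F}}^<(\mathbf{x})>0\}$. For $\mathbf{x}\in\Omega_{\mathsf{F}}$ define $\mathsf{U}_{\mathsf{F}}(\mathbf{x})$ as follows: if $d_{\mathsf{F}}^<(\mathbf{x}),d_{\mathsf{F}}^>(\mathbf{x})<\infty$, $\mathsf{U}_{\mathsf{F}}(\mathbf{x})=\frac{d_{\mathsf{F}}^>(\mathbf{x})a_{\mathsf{F}}(\mathbf{x})+d_{\mathsf{F}}^<(\mathbf{x})b_{\mathsf{F}}(\mathbf{x})}{d_{\mathsf{F}}^>(\mathbf{x})+d_{\mathsf{F}}^<(\mathbf{x})}$;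 if only $d_{\mathsf{F}}^>(\mathbf{x})<\infty$, $\mathsf{U}_{\mathsf{F}}(\mathbf{x})=b_{\mathsf{F}}(\mathbf{x})-d_{\mathsf{F}}^>(\mathbf{x})$; if only $d_{\mathsf{F}}^<(\mathbf{x})<\infty$, $\mathsf{U}_{\mathsf{F}}(\mathbf{x})=a_{\mathsf{F}}(\mathbf{x})+d_{\mathsf{F}}^<(\mathbf{x})$; if both are infinite, $\mathsf{U}_{\mathsf{F}}(\mathbf{x})=\frac12\mathsf{Min}(\mathbf{x})+\frac12\mathsf{Max}(\mathbf{x})$. Call a level set $L=\mathsf{F}^{-1}\{y\}$, $y\in\mathrm{ran}(\mathsf{F})$, exceptional if (1) $\inf\delta_{\mathsf{F}}^{-1}\{y\}\notin\delta_{\mathsf{F}}^{-1}\{y\}$ and there is $\mathbf{x}\in L\cap\Omega_{\mathsf{F}}$ with $d_{\mathsf{F}}^<(\mathbf{x})=0$, or (2) $\sup\delta_{\mathsf{F}}^{-1}\{y\}\notin\delta_{\mathsf{F}}^{-1}\{y\}$ and there is $\mathbf{x}\in L\cap\Omega_{\mathsf{F}}$ with $d_{\mathsf{F}}^>(\mathbf{x})=0$. On non-exceptional level sets, $\mathsf{M}_{\mathsf{F}}(\mathbf{x})=\mathsf{U}_{\mathsf{F}}(\mathbf{x})$ if $\mathbf{x}\in\Omega_{\mathsf{F}}$ and $\mathsf{M}_{\mathsf{F}}(\mathbf{x})=\frac12a_{\mathsf{F}}(\mathbf{x})+\frac12b_{\mathsf{F}}(\mathbf{x})$ if $\mathbf{x}\in\mathbb{I}^n\setminus\Omega_{\mathsf{F}}$.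 On an exceptional level set $\mathsf{F}^{-1}\{y\}$, put $\tilde d_{\mathsf{F}}^<(\mathbf{x})=\mathsf{Max}(\mathbf{x})-a_{\mathsf{F}}(\mathbf{x})$ and $\tilde d_{\mathsf{F}}^>(\mathbf{x})=b_{\mathsf{F}}(\mathbf{x})-\mathsf{Min}(\mathbf{x})$; then $\mathsf{M}_{\mathsf{F}}(\mathbf{x})=\frac{\tilde d_{\mathsf{F}}^>(\mathbf{x})a_{\mathsf{F}}(\mathbf{x})+\tilde d_{\mathsf{F}}^<(\mathbf{x})b_{\mathsf{F}}(\mathbf{x})}{\tilde d_{\mathsf{F}}^>(\mathbf{x})+\tilde d_{\mathsf{F}}^<(\mathbf{x})}$ if both $\mathsf{F}_<^{-1}(y)$ and $\mathsf{F}_>^{-1}(y)$ are nonempty; $\mathsf{M}_{\mathsf{F}}(\mathbf{x})=b_{\mathsf{F}}(\mathbf{x})-\tilde d_{\mathsf{F}}^>(\mathbf{x})=\mathsf{Min}(\mathbf{x})$ if $\mathsf{F}_<^{-1}(y)=\varnothing$; $\mathsf{M}_{\mathsf{F}}(\mathbf{x})=a_{\mathsf{F}}(\mathbf{x})+\tilde d_{\mathsf{F}}^<(\mathbf{x})=\mathsf{Max}(\mathbf{x})$ if $\mathsf{F}_>^{-1}(y)=\varnothing$ (on an exceptional level set these two sets are never both empty). *)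

(* Defs.v *)
From HB Require Import structures.
From mathcomp Require Import all_boot all_order all_algebra.
From mathcomp Require Import all_classical all_reals all_analysis.

Set Implicit Arguments.
Unset Strict Implicit.
Unset Printing Implicit Defensive.

Import Order.TTheory GRing.Theory Num.Theory.
Import numFieldNormedType.Exports.

Local Open Scope classical_set_scope.
Local Open Scope ring_scope.

(* The number of variables is n.+1.  A function on I^(n+1) is represented by a
   total function on row vectors; only its values on [cube I] are ever used. *)

Section Definitions.
Context {R : realType} {n : nat}.
Implicit Types (I : interval R) (F G : 'rV[R]_n.+1 -> R).
Implicit Types (x : 'rV[R]_n.+1) (S : set 'rV[R]_n.+1) (y : R).

Definition cube I : set 'rV[R]_n.+1 := [set x | forall i, x ord0 i \in I].

Definition nondecreasing_each I F :=
  forall (k : 'I_n.+1) x x', cube I x -> cube I x' ->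
    (forall i, i != k -> x ord0 i = x' ord0 i) ->
    x ord0 k <= x' ord0 k -> F x <= F x'.

Definition diag_section F (t : R) : R := F (const_mx t).

Definition idempotent_on I G := forall t, t \in I -> diag_section G t = t.

Definition vmin x : R := \big[Num.min/x ord0 ord0]_i x ord0 i.
Definition vmax x : R := \big[Num.max/x ord0 ord0]_i x ord0 i.

(* The library norm of a row vector is the sup norm; ereal_inf set0 = +oo. *)
Definition dist_inf x S : \bar R :=
  ereal_inf [set (`|x - x'|)%:E | x' in S].

Section MF.
Variables (I : interval R) (F : 'rV[R]_n.+1 -> R).

Definition lower_set y := [set x | cube I x /\ F x < y].
Definition upper_set y := [set x | cube I x /\ F x > y].

Definition diag_level y : set (\bar R) :=
  [set t%:E | t in [set t | t \in I /\ diag_section F t = y]].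

Definition aF x : \bar R := ereal_inf (diag_level (F x)).
Definition bF x : \bar R := ereal_sup (diag_level (F x)).

Definition dlt x : \bar R := dist_inf x (lower_set (F x)).
Definition dgt x : \bar R := dist_inf x (upper_set (F x)).

Definition Omega : set 'rV[R]_n.+1 :=
  [set x | cube I x /\ (0 < dgt x + dlt x)%E].

(* aF x is finite as soon as dlt x is, and bF x as soon as dgt x is, because F
   and its diagonal section have the same range; hence [fine] below is only
   applied to finite values. *)
Definition UF x : R :=
  if (dlt x < +oo)%E && (dgt x < +oo)%E then
    (fine (dgt x) * fine (aF x) + fine (dlt x) * fine (bF x)) /
    (fine (dgt x) + fine (dlt x))
  else if (dgt x < +oo)%E then fine (bF x) - fine (dgt x)
  else if (dlt x < +oo)%E then fine (aF x) + fine (dlt x)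
  else 2^-1 * vmin x + 2^-1 * vmax x.

(* The level set of F at y is exceptional. *)
Definition exceptional y : Prop :=
  (~ diag_level y (ereal_inf (diag_level y)) /\
    exists x, [/\ F x = y, Omega x & dlt x = 0%E]) \/
  (~ diag_level y (ereal_sup (diag_level y)) /\
    exists x, [/\ F x = y, Omega x & dgt x = 0%E]).

Definition dlt_tilde x : R := vmax x - fine (aF x).
Definition dgt_tilde x : R := fine (bF x) - vmin x.

(* On an exceptional level set, lower_set and upper_set are not both empty, so
   the last branch is the one where only upper_set is empty. *)
Definition MF_exceptional x : R :=
  if `[< lower_set (F x) !=set0 /\ upper_set (F x) !=set0 >] then
    (dgt_tilde x * fine (aF x) + dlt_tilde x * fine (bF x)) /
    (dgt_tilde x + dlt_tilde x)
  else if `[< lower_set (F x) = set0 >] then fine (bF x) - dgt_tilde x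
  else fine (aF x) + dlt_tilde x.

Definition MF x : R :=
  if `[< exceptional (F x) >] then MF_exceptional x
  else if `[< Omega x >] then UF x
  else 2^-1 * fine (aF x) + 2^-1 * fine (bF x).

End MF.
End Definitions.

(* Main.v *)
Require Import Defs.
From mathcomp Require Import all_boot all_order all_algebra.
From mathcomp Require Import all_classical all_reals all_analysis.
From mathcomp Require Import ring lra.
Set Implicit Arguments.
Unset Strict Implicit.
Unset Printing Implicit Defensive.

Import Order.TTheory GRing.Theory Num.Theory.
Import numFieldNormedType.Exports.
Local Open Scope classical_set_scope.
Local Open Scope ring_scope.

(** Let [y = F x].  The points of the diagonal at which [F] takes the value [y]
    form an interval [D]; it is nonempty because [F] takes no value outside the
    range of its diagonal section [delta].  Write [a <= b] for its endpoints,
    [L] for the set where [F] is below [y] and [U] for the set where it is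
    above [y].  To say that [M = MF x] lies in the domain and satisfies
    [delta M = F x] is to say that [M] belongs to [D].  Granted this,
    monotonicity between different levels is automatic, since the intervals
    [D] are ordered as the levels are; it remains to compare two points of one
    level, on which [a], [b], [L] and [U] do not change.

    There are two measures of how far [x] is from the ends of its level: a
    lower penalty [q], which is the sup-norm distance from [x] to [L] (or
    [vmax x - a] on an exceptional level), and an upper penalty [p], which is
    the distance to [U] (or [b - vmin x]).  Once [F] is known to be monotone,
    four properties of the penalties hold for both variants, and the
    distinction between exceptional and ordinary levels can be forgotten:
    - [q] is nonnegative and nondecreasing in [x] along a level, and [p] is
      nonnegative and nonincreasing ([lower_penalty_homo]): intersecting a
      competitor [z] of [L] with [x] gives a competitor that is no farther;
    - [vmin x - a <= q <= vmax x - a] and [b - vmax x <= p <= b - vmin x]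
      ([dlt_bounds], [dgt_bounds]), because a point of [L] has a coordinate
      below [a] and the diagonal points just below [a] are in [L];
    - at the diagonal point [(t, ..., t)] this forces [q = t - a] and
      [p = b - t];
    - if [q = 0] (and [x] is in [Omega] on an ordinary level) then [a] belongs
      to [D], and if [p = 0] then [b] does ([lower_penalty_eq0]).  The
      exceptional levels are the ones on which distances would violate this.

    If [L] and [U] are both nonempty, [MF x] is the mean of [a] and [b] with
    weights [p] and [q] ([MF_mean]); if only [U] is, it is [b - p]; if only
    [L] is, it is [a + q]; if [F] is constant, it is the midrange of [x].  In
    each case the value is monotone by the first property, is [t] at
    [(t, ..., t)] by the third one, and lies in [D]: it is between [a] and
    [b], and reaches one of them only if the corresponding penalty is zero,
    which is when that endpoint belongs to [D]. *)

(** * Weighted means of two numbers *)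

Section WeightedMean.
Context {R : realType}.
Implicit Types (a b p q : R).

(** When both weights vanish, any value in [a, b] would keep the mean monotone
    in [q] and antitone in [p]: for nonnegative weights it is [a] as soon as
    only [q] vanishes and [b] as soon as only [p] does. *)
Definition weighted_mean a b p q : R :=
  if 0 < p + q then (p * a + q * b) / (p + q) else 2^-1 * a + 2^-1 * b.

Lemma weighted_mean_bounds a b p q : a <= b -> 0 <= p -> 0 <= q ->
  a <= weighted_mean a b p q <= b.
Proof.
move=> ab p0 q0; rewrite /weighted_mean; case: ltP => pq.
  by rewrite ler_pdivlMr// ler_pdivrMr//; apply/andP; split; nra.
by apply/andP; split; lra.
Qed.

Lemma weighted_mean_eql a b p q : a < b ->
  weighted_mean a b p q = a -> 0 < p + q /\ q = 0.
Proof.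
move=> ab; rewrite /weighted_mean; case: ltP => pq h; last by lra.
have {h} : (p * a + q * b) = a * (p + q) by rewrite -[in RHS]h divfK ?gt_eqF.
move=> h; have : q * (b - a) == 0 by apply/eqP; nra.
by rewrite mulf_eq0 subr_eq0 (gt_eqF ab) orbF => /eqP.
Qed.

Lemma weighted_mean_eqr a b p q : a < b ->
  weighted_mean a b p q = b -> 0 < p + q /\ p = 0.
Proof.
move=> ab; rewrite /weighted_mean; case: ltP => pq h; last by lra.
have {h} : (p * a + q * b) = b * (p + q) by rewrite -[in RHS]h divfK ?gt_eqF.
move=> h; have : p * (b - a) == 0 by apply/eqP; nra.
by rewrite mulf_eq0 subr_eq0 (gt_eqF ab) orbF => /eqP.
Qed.

(** The mean moves towards [b] with the ratio of [q] to [p]: after clearing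
    denominators, the difference of the two sides is
    [(p * q' - p' * q) * (b - a)]. *)
Lemma weighted_mean_homo a b p q p' q' : a <= b ->
  0 <= q -> q <= q' -> 0 <= p' -> p' <= p ->
  weighted_mean a b p q <= weighted_mean a b p' q'.
Proof.
move=> ab q0 qq' p'0 p'p; rewrite /weighted_mean.
case: ltP => pq; case: ltP => p'q' //.
- rewrite ler_pdivrMr// mulrAC ler_pdivlMr//.
  have : 0 <= (p * q' - p' * q) * (b - a).
    by rewrite mulr_ge0// subr_ge0// ler_pM.
  nra.
- rewrite ler_pdivrMr//; have -> : q = 0 by lra.
  nra.
- rewrite ler_pdivlMr//; have -> : p' = 0 by lra.
  nra.
Qed.

Lemma weighted_mean_dist a b t : a <= t <= b ->
  weighted_mean a b (b - t) (t - a) = t.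
Proof.
move=> /andP[at_ tb]; rewrite /weighted_mean; case: ltP => h; last by lra.
by apply: (mulIf (lt0r_neq0 h)); rewrite divfK ?gt_eqF//; ring.
Qed.

End WeightedMean.

(** * Vectors in a cube and the sup norm *)

Section Cube.
Context {R : realType} {n : nat}.
Implicit Types (I : interval R) (x z : 'rV[R]_n.+1) (S : set 'rV[R]_n.+1).

Lemma itv_convex {I} {s t u : R} :
  s \in I -> u \in I -> s <= t -> t <= u -> t \in I.
Proof.
move=> sI uI st tu.
by apply: (@interval_is_interval _ I s u) => //; rewrite st tu.
Qed.

Lemma cube_const {I t} : t \in I -> cube I (const_mx t : 'rV[R]_n.+1).
Proof. by move=> tI i; rewrite mxE. Qed.

Lemma vmin_le x i : vmin x <= x ord0 i.
Proof. exact: bigmin_le. Qed.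

Lemma le_vmax x i : x ord0 i <= vmax x.
Proof. exact: le_bigmax. Qed.

Lemma vmin_attained x : exists i, vmin x = x ord0 i.
Proof.
have /bigmin_leP[h|[i _ h]] := lexx (vmin x).
  by exists ord0; apply/eqP; rewrite eq_le vmin_le.
by exists i; apply/eqP; rewrite eq_le vmin_le.
Qed.

Lemma vmax_attained x : exists i, vmax x = x ord0 i.
Proof.
have /bigmax_geP[h|[i _ h]] := lexx (vmax x).
  by exists ord0; apply/eqP; rewrite eq_le le_vmax andbT.
by exists i; apply/eqP; rewrite eq_le le_vmax andbT.
Qed.

Lemma vmin_le_vmax x : vmin x <= vmax x.
Proof. exact: le_trans (vmin_le x ord0) (le_vmax x ord0). Qed.

Lemma vmin_const (t : R) : vmin (const_mx t : 'rV[R]_n.+1) = t.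
Proof. by have [i ->] := vmin_attained (const_mx t); rewrite mxE. Qed.

Lemma vmax_const (t : R) : vmax (const_mx t : 'rV[R]_n.+1) = t.
Proof. by have [i ->] := vmax_attained (const_mx t); rewrite mxE. Qed.

Lemma vmin_in {I x} : cube I x -> vmin x \in I.
Proof. by have [i ->] := vmin_attained x. Qed.

Lemma vmax_in {I x} : cube I x -> vmax x \in I.
Proof. by have [i ->] := vmax_attained x. Qed.

Lemma vmin_homo {x x'} : (forall i, x ord0 i <= x' ord0 i) -> vmin x <= vmin x'.
Proof.
by move=> xx'; have [i ->] := vmin_attained x'; exact: le_trans (vmin_le x i) _.
Qed.

Lemma vmax_homo {x x'} : (forall i, x ord0 i <= x' ord0 i) -> vmax x <= vmax x'.
Proof.
by move=> xx'; have [i ->] := vmax_attained x; exact: le_trans (le_vmax x' i).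
Qed.

Lemma coord_le_norm x i : `|x ord0 i| <= `|x|.
Proof.
rewrite [leRHS]mx_normrE.
by apply/bigmax_geP; right; exists (ord0, i).
Qed.

Lemma norm_le x (r : R) : (forall i, `|x ord0 i| <= r) -> `|x| <= r.
Proof.
move=> xr; rewrite [leLHS]mx_normrE; apply: bigmax_le.
  exact: le_trans (xr ord0).
by move=> [j i] _ /=; rewrite (ord1 j).
Qed.

Lemma dist_inf_ge0 x S : (0 <= dist_inf x S)%E.
Proof. by apply: le_ereal_inf_tmp => _ [z _ <-]; rewrite lee_fin. Qed.

Lemma dist_inf_le x S z : S z -> (dist_inf x S <= `|x - z|%:E)%E.
Proof. by move=> Sz; apply: ereal_inf_lbound; exists z. Qed.

Lemma dist_inf_set0 x : dist_inf x set0 = +oo%E.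
Proof. by rewrite /dist_inf image_set0 ereal_inf0. Qed.

(** A distance is an infimum over competitors, so it is enough to replace each
    competitor for the second distance by one for the first that is, in every
    coordinate, no farther. *)
Lemma dist_inf_homo x x' S S' :
  (forall z, S z -> exists2 z', S' z' &
     forall i, `|x ord0 i - z' ord0 i| <= `|x' ord0 i - z ord0 i|) ->
  (dist_inf x S' <= dist_inf x' S)%E.
Proof.
move=> SS'; apply: le_ereal_inf_tmp => _ [z /SS'[z' S'z' zz'] <-].
apply: le_trans (dist_inf_le _ S'z') _; rewrite lee_fin.
apply: norm_le => i; rewrite !mxE; apply: le_trans (zz' i) _.
by have := coord_le_norm (x' - z) i; rewrite !mxE.
Qed.

(** Monotonicity in each variable is joint monotonicity: pass from [x] to [x']
    one coordinate at a time, through the vectors that agree with [x'] on the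
    first [k] coordinates and with [x] on the others. *)
Lemma nondecreasing_each_homo {I} {F : 'rV[R]_n.+1 -> R} {x x'} :
  nondecreasing_each I F -> cube I x -> cube I x' ->
  (forall i, x ord0 i <= x' ord0 i) -> F x <= F x'.
Proof.
move=> Fnd Ix Ix' xx'.
pose mix k : 'rV[R]_n.+1 :=
  \row_i if (i < k)%N then x' ord0 i else x ord0 i.
have Imix k : cube I (mix k) by move=> i; rewrite mxE; case: ifP.
have mix0 : mix 0%N = x by apply/rowP => i; rewrite mxE.
have mixn : mix n.+1 = x' by apply/rowP => i; rewrite mxE ltn_ord.
suff step k : (k <= n.+1)%N -> F x <= F (mix k) by rewrite -mixn step.
elim: k => [|k IHk] kn; first by rewrite mix0.
apply: le_trans (IHk (ltnW kn)) _; apply: (Fnd (Ordinal kn)) => // [i ik|].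
  rewrite !mxE ltnS [(i <= k)%N]leq_eqVlt.
  by have /negbTE -> : (i != k :> nat) by move: ik; rewrite -val_eqE.
by rewrite !mxE /= ltnn leqnn.
Qed.

End Cube.

(** * The diagonal endpoints of a level *)

Section LevelSets.
Context {R : realType} {n : nat}.
Variables (I : interval R) (F : 'rV[R]_n.+1 -> R).
Hypothesis Fnd : nondecreasing_each I F.
Hypothesis Fran : diag_section F @` [set` I] = F @` cube I.
Implicit Types (x : 'rV[R]_n.+1).

Local Notation delta := (diag_section F).
Local Notation a x := (fine (aF I F x)).
Local Notation b x := (fine (bF I F x)).
Local Notation L x := (lower_set I F (F x)).
Local Notation U x := (upper_set I F (F x)).

Lemma delta_homo s t : s \in I -> t \in I -> s <= t -> delta s <= delta t.
Proof.
move=> sI tI st; apply: (nondecreasing_each_homo Fnd) => [||i].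
- exact: cube_const.
- exact: cube_const.
- by rewrite !mxE.
Qed.

Lemma delta_vmin_le x : cube I x -> delta (vmin x) <= F x.
Proof.
move=> Ix; apply: (nondecreasing_each_homo Fnd) => // [|i].
  exact/cube_const/vmin_in.
by rewrite mxE vmin_le.
Qed.

Lemma le_delta_vmax x : cube I x -> F x <= delta (vmax x).
Proof.
move=> Ix; apply: (nondecreasing_each_homo Fnd) => // [|i].
  exact/cube_const/vmax_in.
by rewrite mxE le_vmax.
Qed.

(** This is how the hypothesis on ranges is used: whatever value [F] takes, it
    takes on the diagonal. *)
Lemma diag_preimage x : cube I x -> exists2 t, t \in I & delta t = F x.
Proof.
move=> Ix; have : (F @` cube I) (F x) by exists x.
by rewrite -Fran => -[t tI tx]; exists t.
Qed.

Lemma lower_diag x : L x !=set0 -> exists2 s, s \in I & delta s < F x.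
Proof.
move=> [z [Iz zx]]; have [s sI sz] := diag_preimage Iz.
by exists s; rewrite ?sz.
Qed.

Lemma upper_diag x : U x !=set0 -> exists2 s, s \in I & F x < delta s.
Proof.
move=> [z [Iz zx]]; have [s sI sz] := diag_preimage Iz.
by exists s; rewrite ?sz.
Qed.

Lemma delta_lt s t : s \in I -> t \in I -> delta s < delta t -> s < t.
Proof.
by move=> sI tI; apply: contraTT; rewrite -!leNgt; exact: delta_homo.
Qed.

(** The level interval is nonempty, and a diagonal point below the level bounds
    it from below. *)
Lemma aF_fin x : cube I x -> L x !=set0 -> aF I F x = (a x)%:E.
Proof.
move=> Ix /lower_diag[s sI sx]; have [t tI tx] := diag_preimage Ix.
rewrite fineK// fin_real//; apply/andP; split.
  apply: (@lt_le_trans _ _ s%:E); first exact: ltNyr.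
  apply: le_ereal_inf_tmp => _ [u [uI ux] <-]; rewrite lee_fin ltW//.
  by apply: delta_lt => //; rewrite ux.
apply: (@le_lt_trans _ _ t%:E); last exact: ltry.
by apply: ereal_inf_lbound; exists t.
Qed.

Lemma bF_fin x : cube I x -> U x !=set0 -> bF I F x = (b x)%:E.
Proof.
move=> Ix /upper_diag[s sI sx]; have [t tI tx] := diag_preimage Ix.
rewrite fineK// fin_real//; apply/andP; split.
  apply: (@lt_le_trans _ _ t%:E); first exact: ltNyr.
  by apply: ereal_sup_ubound; exists t.
apply: (@le_lt_trans _ _ s%:E); last exact: ltry.
apply: ge_ereal_sup => _ [u [uI ux] <-]; rewrite lee_fin ltW//.
by apply: delta_lt => //; rewrite ux.
Qed.

Lemma aF_le x t :
  cube I x -> L x !=set0 -> t \in I -> delta t = F x -> a x <= t.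
Proof.
move=> Ix Lx tI tx; rewrite -lee_fin -aF_fin//.
by apply: ereal_inf_lbound; exists t.
Qed.

Lemma bF_ge x t :
  cube I x -> U x !=set0 -> t \in I -> delta t = F x -> t <= b x.
Proof.
move=> Ix Ux tI tx; rewrite -lee_fin -bF_fin//.
by apply: ereal_sup_ubound; exists t.
Qed.

Lemma aF_lt_level x t : cube I x -> L x !=set0 -> t \in I ->
  a x < t -> F x <= delta t.
Proof.
move=> Ix Lx tI; rewrite -lte_fin -aF_fin// => /ereal_inf_lt[_ [u [uI <-] <-]].
by rewrite lte_fin => ut; apply: delta_homo => //; exact: ltW.
Qed.

Lemma lt_bF_level x t : cube I x -> U x !=set0 -> t \in I ->
  t < b x -> delta t <= F x.
Proof.
move=> Ix Ux tI; rewrite -lte_fin -bF_fin// => /ereal_sup_gt[_ [u [uI <-] <-]].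
by rewrite lte_fin => ut; apply: delta_homo => //; exact: ltW.
Qed.

Lemma lt_aF_level x t : cube I x -> L x !=set0 -> t \in I ->
  t < a x -> delta t < F x.
Proof.
move=> Ix Lx tI ta; have [u uI ux] := diag_preimage Ix.
have tu : t <= u by apply: le_trans (aF_le Ix Lx uI ux); exact: ltW.
rewrite lt_neqAle -{2}ux delta_homo// andbT; apply/eqP => /(aF_le Ix Lx tI).
by rewrite leNgt ta.
Qed.

Lemma bF_lt_level x t : cube I x -> U x !=set0 -> t \in I ->
  b x < t -> F x < delta t.
Proof.
move=> Ix Ux tI ta; have [u uI ux] := diag_preimage Ix.
have tu : u <= t by apply: le_trans (bF_ge Ix Ux uI ux) _; exact: ltW.
rewrite lt_neqAle -{2}ux delta_homo// andbT.
apply/eqP => /esym/(bF_ge Ix Ux tI).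
by rewrite leNgt ta.
Qed.

Lemma aF_le_vmax x : cube I x -> L x !=set0 -> a x <= vmax x.
Proof.
move=> Ix Lx; rewrite leNgt; apply/negP => /(lt_aF_level Ix Lx (vmax_in Ix)).
by rewrite ltNge le_delta_vmax.
Qed.

Lemma vmin_le_bF x : cube I x -> U x !=set0 -> vmin x <= b x.
Proof.
move=> Ix Ux; rewrite leNgt; apply/negP => /(bF_lt_level Ix Ux (vmin_in Ix)).
by rewrite ltNge delta_vmin_le.
Qed.

(** A diagonal point [s] of the lower set is at most [a x].  If it is too far
    from [a x], move it up to [a x - e / 2], which is in [I] because [a x] is
    at most [vmax x]. *)
Lemma lower_diag_adherent x (e : R) : cube I x -> L x !=set0 -> 0 < e ->
  exists2 s, s \in I /\ delta s < F x & a x - e < s <= a x.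
Proof.
move=> Ix Lx e0; have [s sI sx] := lower_diag Lx.
have sa : s <= a x.
  by rewrite leNgt; apply/negP => /(aF_lt_level Ix Lx sI); rewrite leNgt sx.
have [ea|ea] := ltP (a x - e) s; first by exists s => //; rewrite ea.
have h : a x - e / 2 \in I.
  by apply: (itv_convex sI (vmax_in Ix)); have := aF_le_vmax Ix Lx; lra.
exists (a x - e / 2); last by apply/andP; split; lra.
by split => //; apply: lt_aF_level => //; lra.
Qed.

Lemma upper_diag_adherent x (e : R) : cube I x -> U x !=set0 -> 0 < e ->
  exists2 s, s \in I /\ F x < delta s & b x <= s < b x + e.
Proof.
move=> Ix Ux e0; have [s sI sx] := upper_diag Ux.
have sb : b x <= s.
  by rewrite leNgt; apply/negP => /(lt_bF_level Ix Ux sI); rewrite leNgt sx.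
have [eb|eb] := ltP s (b x + e); first by exists s => //; rewrite sb eb.
have h : b x + e / 2 \in I.
  by apply: (itv_convex (vmin_in Ix) sI); have := vmin_le_bF Ix Ux; lra.
exists (b x + e / 2); last by apply/andP; split; lra.
by split => //; apply: bF_lt_level => //; lra.
Qed.

(** * Distances to the lower and upper sets *)

(** The lower set is closed downwards, so a competitor [z] can be replaced by
    its meet with [x], which is at distance [max 0 (x_i - z_i)] from [x] in
    coordinate [i]. *)
Lemma lower_set_min x z : cube I x -> L x z ->
  L x (\row_i Num.min (x ord0 i) (z ord0 i)).
Proof.
move=> Ix [Iz zx]; have Im : cube I (\row_i Num.min (x ord0 i) (z ord0 i)).
  by move=> i; rewrite mxE; case: (leP (x ord0 i)).
split=> //; apply: le_lt_trans zx; apply: (nondecreasing_each_homo Fnd) => // i.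
by rewrite mxE ge_min lexx orbT.
Qed.

Lemma upper_set_max x z : cube I x -> U x z ->
  U x (\row_i Num.max (x ord0 i) (z ord0 i)).
Proof.
move=> Ix [Iz zx]; have Im : cube I (\row_i Num.max (x ord0 i) (z ord0 i)).
  by move=> i; rewrite mxE; case: (leP (x ord0 i)).
split=> //; apply: lt_le_trans zx _.
apply: (nondecreasing_each_homo Fnd) => // i.
by rewrite mxE le_max lexx orbT.
Qed.

(** The positive part of [x_i - z_i] only grows when [x_i] does. *)
Lemma dlt_homo x x' : cube I x -> cube I x' -> F x = F x' ->
  (forall i, x ord0 i <= x' ord0 i) -> (dlt I F x <= dlt I F x')%E.
Proof.
move=> Ix Ix' xx' le_xx'; rewrite /dlt -xx'; apply: dist_inf_homo => z Lz.
exists (\row_i Num.min (x ord0 i) (z ord0 i)); first exact: lower_set_min.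
move=> i; rewrite mxE; have := le_xx' i.
case: (leP (x ord0 i) (z ord0 i)) => xz xx'i; first by rewrite subrr normr0.
by rewrite !ger0_norm; lra.
Qed.

Lemma dgt_antihomo x x' : cube I x -> cube I x' -> F x = F x' ->
  (forall i, x ord0 i <= x' ord0 i) -> (dgt I F x' <= dgt I F x)%E.
Proof.
move=> Ix Ix' xx' le_xx'; rewrite /dgt xx'; apply: dist_inf_homo => z Uz.
exists (\row_i Num.max (x' ord0 i) (z ord0 i)); first exact: upper_set_max.
move=> i; rewrite mxE; have := le_xx' i.
case: (leP (x' ord0 i) (z ord0 i)) => xz xx'i; last by rewrite subrr normr0.
by rewrite !ler0_norm; lra.
Qed.

(** Otherwise [F z >= delta (vmin z) >= F x]. *)
Lemma vmin_lower_set_le x z : cube I x -> L x !=set0 -> L x z -> vmin z <= a x.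
Proof.
move=> Ix Lx [Iz zx]; rewrite leNgt; apply/negP.
move=> /(aF_lt_level Ix Lx (vmin_in Iz)); rewrite leNgt.
by rewrite (le_lt_trans _ zx)// delta_vmin_le.
Qed.

Lemma vmax_upper_set_ge x z : cube I x -> U x !=set0 -> U x z -> b x <= vmax z.
Proof.
move=> Ix Ux [Iz zx]; rewrite leNgt; apply/negP.
move=> /(lt_bF_level Ix Ux (vmax_in Iz)); rewrite leNgt.
by rewrite (lt_le_trans zx)// le_delta_vmax.
Qed.

(** For the lower bound, look at a coordinate where [z] in the lower set is
    minimal.  For the upper bound, the competitor is the meet of [x] with a
    constant vector just below [a x]. *)
Lemma dlt_bounds x : cube I x -> L x !=set0 ->
  ((vmin x - a x)%:E <= dlt I F x <= (vmax x - a x)%:E)%E.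
Proof.
move=> Ix Lx; apply/andP; split.
  apply: le_ereal_inf_tmp => _ [z Lz <-]; rewrite lee_fin.
  have za := vmin_lower_set_le Ix Lx Lz; have [i zi] := vmin_attained z.
  apply: le_trans (coord_le_norm _ i); rewrite !mxE -zi.
  by apply: le_trans (ler_norm _); have := vmin_le x i; lra.
apply/lee_addgt0Pr => e e0.
have [s [sI sx] /andP[es sa]] := lower_diag_adherent Ix Lx e0.
have Ls : L x (const_mx s) by split => //; exact: cube_const.
apply: le_trans (dist_inf_le _ (lower_set_min Ix Ls)) _.
rewrite -EFinD lee_fin; apply: norm_le => i; rewrite !mxE.
have ax := aF_le_vmax Ix Lx; have xi := le_vmax x i.
by case: (leP (x ord0 i) s) => xs; rewrite ?subrr ?normr0 ?ger0_norm; lra.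
Qed.

Lemma dgt_bounds x : cube I x -> U x !=set0 ->
  ((b x - vmax x)%:E <= dgt I F x <= (b x - vmin x)%:E)%E.
Proof.
move=> Ix Ux; apply/andP; split.
  apply: le_ereal_inf_tmp => _ [z Uz <-]; rewrite lee_fin.
  have zb := vmax_upper_set_ge Ix Ux Uz; have [i zi] := vmax_attained z.
  rewrite distrC.
  apply: le_trans (coord_le_norm _ i); rewrite !mxE -zi.
  by apply: le_trans (ler_norm _); have := le_vmax x i; lra.
apply/lee_addgt0Pr => e e0.
have [s [sI sx] /andP[sb es]] := upper_diag_adherent Ix Ux e0.
have Us : U x (const_mx s) by split => //; exact: cube_const.
apply: le_trans (dist_inf_le _ (upper_set_max Ix Us)) _.
rewrite -EFinD lee_fin; apply: norm_le => i; rewrite !mxE.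
have xb := vmin_le_bF Ix Ux; have xi := vmin_le x i.
by case: (leP (x ord0 i) s) => xs; rewrite ?subrr ?normr0 ?ler0_norm; lra.
Qed.

Lemma dlt_fin x : cube I x -> L x !=set0 -> dlt I F x = (fine (dlt I F x))%:E.
Proof.
move=> Ix /(dlt_bounds Ix)/andP[l u]; rewrite fineK// fin_real//.
by rewrite (lt_le_trans (ltNyr _) l) (le_lt_trans u (ltry _)).
Qed.

Lemma dgt_fin x : cube I x -> U x !=set0 -> dgt I F x = (fine (dgt I F x))%:E.
Proof.
move=> Ix /(dgt_bounds Ix)/andP[l u]; rewrite fineK// fin_real//.
by rewrite (lt_le_trans (ltNyr _) l) (le_lt_trans u (ltry _)).
Qed.

Lemma dlt_pinfty x : ~ (L x !=set0) -> dlt I F x = +oo%E.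
Proof.
by move=> /set0P/negP/negPn/eqP; rewrite /dlt => ->; exact: dist_inf_set0.
Qed.

Lemma dgt_pinfty x : ~ (U x !=set0) -> dgt I F x = +oo%E.
Proof.
by move=> /set0P/negP/negPn/eqP; rewrite /dgt => ->; exact: dist_inf_set0.
Qed.


(** * Penalties *)

Definition lower_penalty x : R :=
  if `[< exceptional I F (F x) >] then vmax x - a x else fine (dlt I F x).

Definition upper_penalty x : R :=
  if `[< exceptional I F (F x) >] then b x - vmin x else fine (dgt I F x).

Lemma lower_penalty_ge0 x : cube I x -> L x !=set0 -> 0 <= lower_penalty x.
Proof.
move=> Ix Lx; rewrite /lower_penalty; case: asboolP => _.
  by rewrite subr_ge0 aF_le_vmax.
by apply: fine_ge0; exact: dist_inf_ge0.
Qed.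

Lemma upper_penalty_ge0 x : cube I x -> U x !=set0 -> 0 <= upper_penalty x.
Proof.
move=> Ix Ux; rewrite /upper_penalty; case: asboolP => _.
  by rewrite subr_ge0 vmin_le_bF.
by apply: fine_ge0; exact: dist_inf_ge0.
Qed.

Lemma lower_penalty_bounds x : cube I x -> L x !=set0 ->
  vmin x - a x <= lower_penalty x <= vmax x - a x.
Proof.
move=> Ix Lx; rewrite /lower_penalty; case: asboolP => _.
  by rewrite lexx lerD2r vmin_le_vmax.
by have := dlt_bounds Ix Lx; rewrite dlt_fin.
Qed.

Lemma upper_penalty_bounds x : cube I x -> U x !=set0 ->
  b x - vmax x <= upper_penalty x <= b x - vmin x.
Proof.
move=> Ix Ux; rewrite /upper_penalty; case: asboolP => _.
  by rewrite lexx lerB ?vmin_le_vmax.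
by have := dgt_bounds Ix Ux; rewrite dgt_fin.
Qed.

(** Here [vmin] and [vmax] agree, so that the bounds on the distance pin it
    down. *)
Lemma lower_penalty_const t : t \in I -> L (const_mx t) !=set0 ->
  lower_penalty (const_mx t) = t - a (const_mx t).
Proof.
move=> tI Lt; have It : cube I (const_mx t : 'rV[R]_n.+1) := cube_const tI.
rewrite /lower_penalty; case: asboolP => _.
  by rewrite vmax_const.
have := dlt_bounds It Lt; rewrite dlt_fin//= vmin_const vmax_const.
by rewrite !lee_fin => /le_anti.
Qed.

Lemma upper_penalty_const t : t \in I -> U (const_mx t) !=set0 ->
  upper_penalty (const_mx t) = b (const_mx t) - t.
Proof.
move=> tI Ut; have It : cube I (const_mx t : 'rV[R]_n.+1) := cube_const tI.
rewrite /upper_penalty; case: asboolP => _.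
  by rewrite vmin_const.
have := dgt_bounds It Ut; rewrite dgt_fin//= vmin_const vmax_const.
by rewrite !lee_fin => /le_anti.
Qed.

Lemma lower_penalty_homo x x' : cube I x -> cube I x' -> F x = F x' ->
  L x !=set0 -> (forall i, x ord0 i <= x' ord0 i) ->
  lower_penalty x <= lower_penalty x'.
Proof.
move=> Ix Ix' xx' Lx le_xx'; have Lx' : L x' !=set0 by rewrite -xx'.
rewrite /lower_penalty /aF xx'; case: asboolP => _.
  by rewrite lerD2r vmax_homo.
by rewrite -lee_fin -!dlt_fin// dlt_homo.
Qed.

Lemma upper_penalty_antihomo x x' : cube I x -> cube I x' -> F x = F x' ->
  U x !=set0 -> (forall i, x ord0 i <= x' ord0 i) ->
  upper_penalty x' <= upper_penalty x.
Proof.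
move=> Ix Ix' xx' Ux le_xx'; have Ux' : U x' !=set0 by rewrite -xx'.
rewrite /upper_penalty /bF xx'; case: asboolP => _.
  by rewrite lerB// vmin_homo.
by rewrite -lee_fin -!dgt_fin// dgt_antihomo.
Qed.

(** On an exceptional level, a zero penalty means [vmax x = a x], and
    [F x <= delta (vmax x)].  On an ordinary level, [x] would make the level
    exceptional if [a x] were not in its level interval. *)
Lemma lower_penalty_eq0 x : cube I x -> L x !=set0 ->
  exceptional I F (F x) \/ Omega I F x ->
  lower_penalty x = 0 -> F x <= delta (a x).
Proof.
move=> Ix Lx; rewrite /lower_penalty; case: asboolP => [_ _|nex [//|Ox] d0].
  by move/subr0_eq <-; exact: le_delta_vmax.
have [[t [tI tx] ta]|na] := pselect (diag_level I F (F x) (aF I F x)).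
  by rewrite -ta /= tx.
case: nex; left; split=> //; exists x; split=> //.
by rewrite dlt_fin// d0.
Qed.

Lemma upper_penalty_eq0 x : cube I x -> U x !=set0 ->
  exceptional I F (F x) \/ Omega I F x ->
  upper_penalty x = 0 -> delta (b x) <= F x.
Proof.
move=> Ix Ux; rewrite /upper_penalty; case: asboolP => [_ _|nex [//|Ox] d0].
  by move/subr0_eq ->; exact: delta_vmin_le.
have [[t [tI tx] ta]|na] := pselect (diag_level I F (F x) (bF I F x)).
  by rewrite -ta /= tx.
case: nex; right; split=> //; exists x; split=> //.
by rewrite dgt_fin// d0.
Qed.

Lemma aF_le_bF x : cube I x -> L x !=set0 -> U x !=set0 -> a x <= b x.
Proof.
move=> Ix Lx Ux; have [t tI tx] := diag_preimage Ix.
by apply: le_trans (bF_ge Ix Ux tI tx); exact: aF_le.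
Qed.

(** The level interval is nonempty; if its endpoints coincide, it is the
    singleton that they form. *)
Lemma level_endpoint x : cube I x -> L x !=set0 -> U x !=set0 ->
  a x = b x -> delta (a x) = F x.
Proof.
move=> Ix Lx Ux ab; have [t tI tx] := diag_preimage Ix.
suff -> : a x = t by [].
by apply/eqP; rewrite eq_le aF_le//= ab bF_ge.
Qed.

(** An exceptional level lacks an endpoint of its level interval, which
    therefore is not a point.  This makes the denominator in [MF_exceptional]
    positive. *)
Lemma exceptional_lt x : cube I x -> L x !=set0 -> U x !=set0 ->
  exceptional I F (F x) -> a x < b x.
Proof.
move=> Ix Lx Ux ex; rewrite lt_neqAle aF_le_bF// andbT; apply/eqP => ab.
have [t tI tx] := diag_preimage Ix.
have ta : a x = t.
  by apply/eqP; rewrite eq_le aF_le//= ab bF_ge.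
have lev : diag_level I F (F x) t%:E by exists t.
case: ex => -[+ _]; apply.
  by rewrite -[ereal_inf _]/(aF I F x) aF_fin// ta.
by rewrite -[ereal_sup _]/(bF I F x) bF_fin// -ab ta.
Qed.


(** * Closed forms of [MF] *)

Lemma Omega_finiteE x : cube I x -> L x !=set0 -> U x !=set0 ->
  Omega I F x <-> 0 < fine (dgt I F x) + fine (dlt I F x).
Proof.
move=> Ix Lx Ux; rewrite /Omega /= dlt_fin// dgt_fin// -EFinD lte_fin /=.
by split => [[]|].
Qed.

Lemma MF_mean x : cube I x -> L x !=set0 -> U x !=set0 ->
  MF I F x =
  weighted_mean (a x) (b x) (upper_penalty x) (lower_penalty x).
Proof.
move=> Ix Lx Ux; rewrite /MF /upper_penalty /lower_penalty.
case: asboolP => [ex|_].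
  rewrite /MF_exceptional; case: asboolP => [_|[]//].
  rewrite /weighted_mean ifT// /dgt_tilde /dlt_tilde.
  by have := exceptional_lt Ix Lx Ux ex; have := vmin_le_vmax x; lra.
rewrite /weighted_mean; case: asboolP => [Ox|nOx].
  have -> := (Omega_finiteE Ix Lx Ux).1 Ox.
  by rewrite /UF dlt_fin// dgt_fin// !ltry.
by case: ifP => // /(Omega_finiteE Ix Lx Ux).2.
Qed.

Lemma Omega_lower_set0 x : cube I x -> ~ (L x !=set0) -> Omega I F x.
Proof.
move=> Ix Lx; split=> //; rewrite (dlt_pinfty Lx) addey ?ltry//.
by rewrite gt_eqF// (lt_le_trans _ (dist_inf_ge0 _ _)).
Qed.

Lemma Omega_upper_set0 x : cube I x -> ~ (U x !=set0) -> Omega I F x.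
Proof.
move=> Ix Ux; split=> //; rewrite (dgt_pinfty Ux) addye ?ltry//.
by rewrite gt_eqF// (lt_le_trans _ (dist_inf_ge0 _ _)).
Qed.

Lemma MF_lower_set0 x : cube I x -> ~ (L x !=set0) -> U x !=set0 ->
  MF I F x = b x - upper_penalty x.
Proof.
move=> Ix Lx Ux; rewrite /MF /upper_penalty.
case: asboolP => [ex|_].
  rewrite /MF_exceptional; case: asboolP => [[]//|_].
  by case: asboolP => // Lx0; case: Lx; apply/set0P/eqP.
case: asboolP => [_|]; last by case; exact: Omega_lower_set0.
by rewrite /UF (dlt_pinfty Lx) ltxx /= dgt_fin// ltry.
Qed.

Lemma MF_upper_set0 x : cube I x -> L x !=set0 -> ~ (U x !=set0) ->
  MF I F x = a x + lower_penalty x.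
Proof.
move=> Ix Lx Ux; rewrite /MF /lower_penalty.
case: asboolP => [ex|_].
  rewrite /MF_exceptional; case: asboolP => [[]//|_].
  by case: asboolP => // Lx0; move: Lx; rewrite Lx0 => -[].
case: asboolP => [_|]; last by case; exact: Omega_upper_set0.
by rewrite /UF (dgt_pinfty Ux) ltxx /= dlt_fin// ltry.
Qed.

(** If [F] is constant, its unique level is not exceptional: all distances to
    the empty lower and upper sets are infinite, hence none is zero. *)
Lemma MF_midrange x : cube I x -> ~ (L x !=set0) -> ~ (U x !=set0) ->
  MF I F x = 2^-1 * vmin x + 2^-1 * vmax x.
Proof.
move=> Ix Lx Ux; rewrite /MF; case: asboolP => [|_].
  case=> -[_ [z [zx _]]].
    by rewrite dlt_pinfty// zx.
  by rewrite dgt_pinfty// zx.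
case: asboolP => [_|]; last by case; exact: Omega_lower_set0.
by rewrite /UF (dlt_pinfty Lx) (dgt_pinfty Ux) ltxx.
Qed.


Lemma penalties_gt0 x : cube I x -> L x !=set0 -> U x !=set0 ->
  0 < upper_penalty x + lower_penalty x ->
  exceptional I F (F x) \/ Omega I F x.
Proof.
move=> Ix Lx Ux; rewrite /lower_penalty /upper_penalty.
by case: asboolP => [|_ /(Omega_finiteE Ix Lx Ux).2]; [left|right].
Qed.

(** * Level, monotonicity and idempotency of [MF] *)

Lemma lower_set0_le x t : ~ (L x !=set0) -> t \in I -> F x <= delta t.
Proof.
move=> Lx tI; rewrite leNgt; apply/negP => tx; apply: Lx.
by exists (const_mx t); split => //; exact: cube_const.
Qed.

Lemma upper_set0_ge x t : ~ (U x !=set0) -> t \in I -> delta t <= F x.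
Proof.
move=> Ux tI; rewrite leNgt; apply/negP => tx; apply: Ux.
by exists (const_mx t); split => //; exact: cube_const.
Qed.

(** A value strictly between the endpoints is on the level by definition of an
    infimum and a supremum.  An endpoint is reached only when the penalty
    attached to it vanishes, or when both endpoints coincide. *)
Lemma MF_level x : cube I x -> MF I F x \in I /\ delta (MF I F x) = F x.
Proof.
move=> Ix; have Vx := vmin_le_vmax x.
have inI t : vmin x <= t <= vmax x -> t \in I.
  by case/andP; exact: itv_convex (vmin_in Ix) (vmax_in Ix).
have [Lx|Lx] := pselect (L x !=set0); have [Ux|Ux] := pselect (U x !=set0).
- rewrite MF_mean//; have ab := aF_le_bF Ix Lx Ux.
  have p0 := upper_penalty_ge0 Ix Ux; have q0 := lower_penalty_ge0 Ix Lx.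
  have /andP[am mb] := weighted_mean_bounds ab p0 q0.
  set m := weighted_mean _ _ _ _ in am mb *.
  have mI : m \in I.
    (* [a x] and [b x] are themselves flanked by points of [I]; the precision
       1 is arbitrary. *)
    have [s [sI _] /andP[_ sa]] := lower_diag_adherent Ix Lx ltr01.
    have [u [uI _] /andP[bu _]] := upper_diag_adherent Ix Ux ltr01.
    by apply: (itv_convex sI uI); [exact: le_trans am|exact: le_trans bu].
  split=> //; apply/le_anti/andP; split.
    have [m_lt|m_ge] := ltP m (b x); first exact: lt_bF_level.
    have mE : m = b x by apply/le_anti; rewrite mb.
    have [lt_ab|ba] := ltP (a x) (b x).
      have [pq0 p_eq0] := weighted_mean_eqr lt_ab mE.
      rewrite mE; apply: upper_penalty_eq0 => //; exact: penalties_gt0.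
    have abE : a x = b x by apply/le_anti; rewrite ab.
    by rewrite mE -abE level_endpoint.
  have [m_gt|m_le] := ltP (a x) m; first exact: aF_lt_level.
  have mE : m = a x by apply/le_anti; rewrite am m_le.
  have [lt_ab|ba] := ltP (a x) (b x).
    have [pq0 p_eq0] := weighted_mean_eql lt_ab mE.
    rewrite mE; apply: lower_penalty_eq0 => //; exact: penalties_gt0.
  have abE : a x = b x by apply/le_anti; rewrite ab.
  by rewrite mE level_endpoint.
- rewrite MF_upper_set0//; have q0 := lower_penalty_ge0 Ix Lx.
  have /andP[ql qu] := lower_penalty_bounds Ix Lx.
  have mI : a x + lower_penalty x \in I by apply: inI; apply/andP; split; lra.
  split=> //; apply/le_anti; rewrite upper_set0_ge//=.
  have [qgt|qle] := ltP 0 (lower_penalty x).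
    by apply: aF_lt_level => //; lra.
  have qE : lower_penalty x = 0 by apply/le_anti; rewrite qle.
  rewrite qE addr0; apply: lower_penalty_eq0 => //; right.
  exact: Omega_upper_set0.
- rewrite MF_lower_set0//; have p0 := upper_penalty_ge0 Ix Ux.
  have /andP[pl pu] := upper_penalty_bounds Ix Ux.
  have mI : b x - upper_penalty x \in I by apply: inI; apply/andP; split; lra.
  split=> //; apply/le_anti; rewrite [X in _ && X]lower_set0_le// andbT.
  have [pgt|ple] := ltP 0 (upper_penalty x).
    by apply: lt_bF_level => //; lra.
  have pE : upper_penalty x = 0 by apply/le_anti; rewrite ple.
  rewrite pE subr0; apply: upper_penalty_eq0 => //; right.
  exact: Omega_lower_set0.
- rewrite MF_midrange//.
  have mI : 2^-1 * vmin x + 2^-1 * vmax x \in I.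
    by apply: inI; apply/andP; split; lra.
  by split=> //; apply/le_anti; rewrite upper_set0_ge// lower_set0_le.
Qed.

Lemma MF_homo_level x x' : cube I x -> cube I x' -> F x = F x' ->
  (forall i, x ord0 i <= x' ord0 i) -> MF I F x <= MF I F x'.
Proof.
move=> Ix Ix' xx' le_xx'.
have aE : a x = a x' by rewrite /aF xx'.
have bE : b x = b x' by rewrite /bF xx'.
have [Lx|Lx] := pselect (L x !=set0); have [Ux|Ux] := pselect (U x !=set0);
  have := Lx; have := Ux; rewrite {1}xx' => Ux'; rewrite {1}xx' => Lx'.
- rewrite !MF_mean// -aE -bE; apply: weighted_mean_homo.
  + exact: aF_le_bF.
  + exact: lower_penalty_ge0.
  + exact: lower_penalty_homo.
  + exact: upper_penalty_ge0.
  + exact: upper_penalty_antihomo.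
- by rewrite !MF_upper_set0// aE lerD2l lower_penalty_homo.
- by rewrite !MF_lower_set0// bE lerB// upper_penalty_antihomo.
- rewrite !MF_midrange//.
  by have := vmin_homo le_xx'; have := vmax_homo le_xx'; lra.
Qed.

Lemma MF_const t : t \in I -> MF I F (const_mx t) = t.
Proof.
move=> tI; set x : 'rV[R]_n.+1 := const_mx t.
have Ix : cube I x := cube_const tI.
have [Lx|Lx] := pselect (L x !=set0); have [Ux|Ux] := pselect (U x !=set0).
- rewrite MF_mean// lower_penalty_const// upper_penalty_const//.
  by rewrite weighted_mean_dist// aF_le// bF_ge.
- by rewrite MF_upper_set0// lower_penalty_const// subrKC.
- by rewrite MF_lower_set0// upper_penalty_const// subKr.
- by rewrite MF_midrange// vmin_const vmax_const; lra.
Qed.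

End LevelSets.

Theorem theorem4p4 (R : realType) (n : nat) (I : interval R)
    (F : 'rV[R]_n.+1 -> R) :
  [set` I] !=set0 ->
  nondecreasing_each I F ->
  diag_section F @` [set` I] = F @` cube I ->
  [/\ MF I F @` cube I `<=` [set` I],
      forall x, cube I x -> F x = diag_section F (MF I F x),
      nondecreasing_each I (MF I F) &
      idempotent_on I (MF I F)].
Proof.
move=> _ Fnd Fran; split.
- by move=> _ [x Ix <-]; exact: (MF_level Fnd Fran Ix).1.
- by move=> x Ix; rewrite (MF_level Fnd Fran Ix).2.
- move=> k x x' Ix Ix' eq_xx' le_k.
  have le_xx' i : x ord0 i <= x' ord0 i.
    by have [->//|/eq_xx' ->] := eqVneq i k.
  have := nondecreasing_each_homo Fnd Ix Ix' le_xx'.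
  rewrite le_eqVlt => /predU1P[eq_F|lt_F].
    exact: (MF_homo_level Fnd Fran Ix Ix' eq_F).
  have [MxI Mx] := MF_level Fnd Fran Ix.
  have [Mx'I Mx'] := MF_level Fnd Fran Ix'.
  by apply/ltW/(delta_lt Fnd MxI Mx'I); rewrite Mx Mx'.
- by move=> t tI; exact: (MF_const Fnd Fran).
Qed.
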